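(* Let $m\ge 2$, $n\ge 1$ and $q_1,\ldots,q_m\ge 1$ be integers, and for each $i=1,\ldots,m$ let $\boldsymbol{A}^{(i)}=[A^{(i)}_{kl}]_{k,l=1}^n\in \mathbb{M}_n(\mathbb{M}_{q_i})$ be positive semidefinite, with diagonal blocks $A^{(i)}_{\mu\mu}$, $1\le\mu\le n$. Then $$\det\left(\prod_{i=1}^m *\boldsymbol{A}^{(i)}\right)+(m-1)\prod_{i=1}^m\left(\det \boldsymbol{A}^{(i)}\right)^{\frac{q_1q_2\cdots q_m}{q_i}}\ \ge\ \sum_{i=1}^m\left(\prod_{\mu=1}^n\det A^{(i)}_{\mu\mu}\right)^{\frac{q_1q_2\cdots q_m}{q_i}}\prod_{\substack{j=1\\ j\ne i}}^m\left(\det \boldsymbol{A}^{(j)}\right)^{\frac{q_1q_2\cdots q_m}{q_j}},$$ where $\prod_{i=1}^m *\boldsymbol{A}^{(i)}$ is the Khatri-Rao product of $\boldsymbol{A}^{(1)},\ldots,\boldsymbol{A}^{(m)}$.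
   Context: All matrices are complex; positive semidefinite means Hermitian positive semidefinite. $\mathbb{M}_q$ is the set of $q\times q$ complex matrices, and $\mathbb{M}_n(\mathbb{M}_q)$ is the set of complex $nq\times nq$ matrices partitioned into $n\times n$ blocks, each block being a $q\times q$ matrix. For matrices $X=[x_{kl}]$ of order $p\times p$ and $Y$, the Kronecker product is the block matrix $X\otimes Y=[x_{kl}Y]_{k,l=1}^{p}$. For $\boldsymbol{A}=[A_{kl}]\in\mathbb{M}_n(\mathbb{M}_p)$ and $\boldsymbol{B}=[B_{kl}]\in\mathbb{M}_n(\mathbb{M}_q)$, the Khatri-Rao product is $\boldsymbol{A}*\boldsymbol{B}:=[A_{kl}\otimes B_{kl}]_{k,l=1}^n\in\mathbb{M}_n(\mathbb{M}_{pq})$. This product is associative, and $\prod_{i=1}^m*\boldsymbol{A}^{(i)}$ denotes $\boldsymbol{A}^{(1)}*\boldsymbol{A}^{(2)}*\cdots*\boldsymbol{A}^{(m)}$, i.e. the block matrix whose $(k,l)$ block is $A^{(1)}_{kl}\otimes\cdots\otimes A^{(m)}_{kl}$. *)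

(* Defs.v *)
From mathcomp Require Import all_boot all_order all_algebra.
From mathcomp Require Import reals complex mxtens.

Set Implicit Arguments.
Unset Strict Implicit.
Unset Printing Implicit Defensive.

Import Order.TTheory GRing.Theory Num.Theory.
Local Open Scope ring_scope.

(* In a numClosedFieldType, [0 <= z] entails that z is real. *)
Definition psdmx (C : numClosedFieldType) (d : nat) (A : 'M[C]_d) : Prop :=
  A \is hermsymmx /\
  forall v : 'cV[C]_d, 0 <= ((map_mx Num.conj v)^T *m A *m v) 0 0.

(* M_n(M_q): square matrices of order \sum_(k < n) q = n * q, in the format
   expected by [submxblock] and [\mxblock], so that for A : blockmx C n q the
   matrix [submxblock A k l : 'M_q] is the block A_kl. *)
Notation blockmx C n q := 'M[C]_(\sum_(k < n) q%N).

Definition mxblk (C : Type) (n q : nat) (A : blockmx C n q) (k l : 'I_n) :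
  'M[C]_q := @submxblock C n n (fun=> q) (fun=> q) A k l.

(* [tensmx X Y] is the Kronecker product [x_kl Y]. *)
Definition khatri_rao (C : pzRingType) (n p q : nat)
    (A : blockmx C n p) (B : blockmx C n q) : blockmx C n (p * q) :=
  \mxblock_(k < n, l < n) tensmx (mxblk A k l) (mxblk B k l).

(* Sizes and products of nonempty families, associated to the left:
   ((q_1 * q_2) * ...) * q_m and ((A_1 * A_2) * ...) * A_m. *)
Fixpoint khatri_rao_dimS (m : nat) : ('I_m.+1 -> nat) -> nat :=
  match m with
  | 0 => fun q => q ord0
  | m'.+1 => fun q =>
      (khatri_rao_dimS (fun i : 'I_m'.+1 => q (widen_ord (leqnSn _) i))
       * q ord_max)%N
  end.

Fixpoint khatri_rao_prodS (C : pzRingType) (n m : nat) :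
    forall (q : 'I_m.+1 -> nat), (forall i, blockmx C n (q i)) ->
      blockmx C n (khatri_rao_dimS q) :=
  match m with
  | 0 => fun q A => A ord0
  | m'.+1 => fun q A =>
      khatri_rao
        (khatri_rao_prodS (fun i : 'I_m'.+1 => A (widen_ord (leqnSn _) i)))
        (A ord_max)
  end.

(* The empty product is the neutral element of [khatri_rao], all of whose
   1 x 1 blocks are equal to 1. *)
Definition khatri_rao_dim (m : nat) : ('I_m -> nat) -> nat :=
  match m with
  | 0 => fun=> 1%N
  | _.+1 => fun q => khatri_rao_dimS q
  end.

Definition khatri_rao_prod (C : pzRingType) (n m : nat) :
    forall (q : 'I_m -> nat), (forall i, blockmx C n (q i)) ->
      blockmx C n (khatri_rao_dim q) :=
  match m with
  | 0 => fun q A => const_mx 1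
  | _.+1 => fun q A => khatri_rao_prodS A
  end.

(* Main.v *)
(** Every positive semidefinite A has an L D L^* factorization.  Grouping the
columns of L by blocks writes A as a sum of positive semidefinite F_k supported
on the blocks of index at least k, with det A = prod_k det (F_k)_kk; conversely,
for any such family, det (sum_k F_k) >= prod_k det (F_k)_kk.  If (F_k) and (G_k)
decompose A and B, then A * B is the sum of the matrices
  H_k = F_k * G_k + (sum_{l<k} F_l) * G_k + F_k * (sum_{l<k} G_l),
which have the same support property.  Since A_kk is the block (k,k) of
sum_{l<=k} F_l, and likewise for B, the inequality
det (M + X + Y) + det M >= det (M + X) + det (M + Y) for positive semidefinite
matrices bounds det (H_k)_kk from below, and multiplying over k settles two
factors.  For m factors, the two-factor inequality is applied to the product of
the first m - 1 factors and the last one; what remains is the elementary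
prod P_i + (m-1) prod d_i >= sum_i P_i prod_{j<>i} d_j for P_i >= d_i >= 0. *)

Require Import Defs.
From mathcomp Require Import all_boot all_order all_algebra.
From mathcomp Require Import reals complex mxtens.
From mathcomp Require Import perm ring.

Set Implicit Arguments.
Unset Strict Implicit.
Unset Printing Implicit Defensive.

Import Order.TTheory GRing.Theory Num.Theory.
Local Open Scope ring_scope.

Local Notation "A ^H" := ((map_mx Num.conj A)^T) (at level 8, format "A ^H").
(** Block containing a global index; [tagnat.sig2] is the position inside it and [tagnat.Rank]
    recombines the two. *)
Local Notation blk := (@tagnat.sig1 _ (fun=> _)).

(** * Determinants of block-diagonal matrices and Kronecker products *)

Lemma det_castmx (R : comPzRingType) (m n : nat) (e : m = n) (A : 'M[R]_m) :
  \det (castmx (e, e) A) = \det A.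
Proof. by case: n / e; rewrite castmx_id. Qed.

(** The two sizes agree, so [f] permutes rows and columns alike and its sign occurs squared. *)
Lemma det_mxsub_bij (R : comPzRingType) (m n : nat) (f : 'I_m -> 'I_n)
    (A : 'M[R]_n) : bijective f -> \det (mxsub f f A) = \det A.
Proof.
move=> bij_f; have e : m = n by have := bij_eq_card bij_f; rewrite !card_ord.
case: n / e in f bij_f A *.
have -> : mxsub f f A =
    row_perm (perm (bij_inj bij_f)) (col_perm (perm (bij_inj bij_f)) A).
  by apply/matrixP=> i j; rewrite !mxE !permE.
rewrite row_permE col_permE !det_mulmx !det_perm.
by rewrite odd_permV mulrCA -expr2 sqrr_sign mulr1.
Qed.

Lemma det_mxdiag (R : comPzRingType) (n : nat) (p : 'I_n -> nat)
    (B : forall i, 'M[R]_(p i)) : \det (mxdiag B) = \prod_i \det (B i).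
Proof.
elim: n => [|n IHn] in p B *.
  by rewrite [RHS]big_ord0; move: (mxdiag B); rewrite big_ord0 => M; exact: det_mx00.
by rewrite mxdiag_recl det_castmx det_ublock IHn big_ord_recl.
Qed.

Lemma det_tens1mx (R : comNzRingType) (p q : nat) (B : 'M[R]_q) :
  \det (tensmx (1%:M : 'M_p) B) = \det B ^+ p.
Proof.
elim: p => [|p IHp]; first by rewrite det_mx00.
rewrite (_ : 1%:M = block_mx (1%:M : 'M_1) 0 0 (1%:M : 'M_p)); last first.
  by rewrite -scalar_mx_block.
rewrite tens_block_mx det_castmx !tens0mx det_ublock tens_scalar1mx det_castmx.
by rewrite IHp exprS.
Qed.

Lemma det_tensmx1 (R : comNzRingType) (p q : nat) (A : 'M[R]_p) :
  \det (tensmx A (1%:M : 'M_q)) = \det A ^+ q.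
Proof.
(* Swapping the two Kronecker indices reduces to a left factor 1. *)
pose f (k : 'I_(p * q)) : 'I_(q * p) :=
  mxtens_index ((mxtens_unindex k).2, (mxtens_unindex k).1).
pose g (k : 'I_(q * p)) : 'I_(p * q) :=
  mxtens_index ((mxtens_unindex k).2, (mxtens_unindex k).1).
have bij_f : bijective f.
  by exists g => k; rewrite /f /g mxtens_indexK -?surjective_pairing mxtens_unindexK.
rewrite -det_tens1mx -(det_mxsub_bij _ bij_f); congr (\det _).
by apply/matrixP=> i j; rewrite !mxE !mxtens_indexK mulrC.
Qed.

Lemma det_tens (R : comNzRingType) (p q : nat) (A : 'M[R]_p) (B : 'M[R]_q) :
  \det (tensmx A B) = \det A ^+ q * \det B ^+ p.
Proof. by rewrite tensmx_decr det_mulmx det_tensmx1 det_tens1mx. Qed.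

(** Expansion along row [i], whose cofactors do not see the added entry. *)
Lemma det_add_delta (R : comNzRingType) (n : nat) (A : 'M[R]_n) (i : 'I_n)
    (c : R) :
  \det (A + c *: delta_mx i i) = \det A + c * \det (row' i (col' i A)).
Proof.
have cof j : cofactor (A + c *: delta_mx i i) i j = cofactor A i j.
  rewrite /cofactor; congr (_ * \det _); apply/matrixP=> k l; rewrite !mxE.
  by rewrite (eq_sym _ i) (negPf (neq_lift _ _)) mulr0 addr0.
rewrite (expand_det_row A i) (expand_det_row _ i).
rewrite (bigD1 i) //= [in RHS](bigD1 i) //=.
rewrite !mxE !eqxx mulr1 cof mulrDl -!addrA; congr (_ + _).
rewrite [RHS]addrC; congr (_ + _).
  by rewrite /cofactor addnn -mul2n exprM sqrrN !expr1n mul1r.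
by apply: eq_bigr => j /negPf ne; rewrite cof !mxE ne andbF mulr0 addr0.
Qed.

Lemma tensmxDl (R : pzRingType) (m n p q : nat) (A B : 'M[R]_(m, n))
    (D : 'M_(p, q)) :
  tensmx (A + B) D = tensmx A D + tensmx B D.
Proof. by apply/matrixP=> i j; rewrite !mxE mulrDl. Qed.

Lemma tensmxDr (R : pzRingType) (m n p q : nat) (A : 'M[R]_(m, n))
    (B D : 'M_(p, q)) :
  tensmx A (B + D) = tensmx A B + tensmx A D.
Proof. by apply/matrixP=> i j; rewrite !mxE mulrDr. Qed.

(** * Scalar inequalities and identities *)

(** The hypotheses bound [c] below by [u * t + s * (v - t)], and [c'] likewise. The product of these
    nonnegative bounds exceeds the required one by two mixed terms, nonnegative since [s <= u] and
    [s' <= u']. *)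
Lemma oppenheim_step (R : numDomainType) (s u t v c s' u' t' v' c' : R) :
  0 <= s <= u -> 0 <= t <= v -> u * t + s * v <= c + s * t ->
  0 <= s' <= u' -> 0 <= t' <= v' -> u' * t' + s' * v' <= c' + s' * t' ->
  (u * u') * (t * t') + (s * s') * (v * v') <= c * c' + (s * s') * (t * t').
Proof.
move=> /andP [s0 su] /andP [t0 tv] hc /andP [s0' su'] /andP [t0' tv'] hc'.
have bound (a b x y : R) : 0 <= a <= b -> 0 <= x <= y -> 0 <= b * x + a * (y - x).
  move=> /andP [a0 ab] /andP [x0 xy].
  by rewrite addr_ge0 ?mulr_ge0 ?subr_ge0 // (le_trans a0).
have le_c : (u * t + s * (v - t)) * (u' * t' + s' * (v' - t')) <= c * c'.
  apply: ler_pM; rewrite ?bound ?s0 ?t0 ?s0' ?t0' //.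
    by rewrite mulrBr addrA lerBlDr.
  by rewrite mulrBr addrA lerBlDr.
rewrite -lerBlDr; apply: le_trans le_c; rewrite -subr_ge0.
have -> : (u * t + s * (v - t)) * (u' * t' + s' * (v' - t')) -
    (u * u' * (t * t') + s * s' * (v * v') - s * s' * (t * t')) =
    (u - s) * t * (s' * (v' - t')) + (u' - s') * t' * (s * (v - t)) by ring.
by rewrite addr_ge0 // !mulr_ge0 ?subr_ge0.
Qed.

Lemma oppenheim_prod (R : numDomainType) (n : nat) (s u t v c : 'I_n -> R) :
  (forall k, 0 <= s k <= u k) -> (forall k, 0 <= t k <= v k) ->
  (forall k, u k * t k + s k * v k <= c k + s k * t k) ->
  (\prod_k u k) * (\prod_k t k) + (\prod_k s k) * (\prod_k v k) <=
    \prod_k c k + (\prod_k s k) * (\prod_k t k).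
Proof.
move=> su tv h.
(* The bounds on partial products are carried along, since [oppenheim_step] asks for them. *)
suff [] : [/\ 0 <= \prod_k s k <= \prod_k u k, 0 <= \prod_k t k <= \prod_k v k &
  (\prod_k u k) * (\prod_k t k) + (\prod_k s k) * (\prod_k v k) <=
    \prod_k c k + (\prod_k s k) * (\prod_k t k)] by [].
elim: (index_enum _) => [|k r [IHs IHt IH]].
  by rewrite !big_nil !mulr1 !lexx !ler01.
rewrite !big_cons; split; last exact: oppenheim_step.
  have [/andP [? ?] /andP [? ?]] := (su k, IHs).
  by rewrite mulr_ge0 // ler_pM.
have [/andP [? ?] /andP [? ?]] := (tv k, IHt).
by rewrite mulr_ge0 // ler_pM.
Qed.

Section SumProd.

Variables (R : comPzRingType) (n : nat) (P d : 'I_n.+1 -> R).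
Local Notation w := (widen_ord (leqnSn n)).

Lemma sum_prod_neq_recr :
  \sum_i P i * \prod_(j | j != i) d j =
  (\sum_i P (w i) * \prod_(j | j != i) d (w j)) * d ord_max
  + P ord_max * \prod_j d (w j).
Proof.
rewrite big_ord_recr /=; congr (_ + _ * _).
  rewrite mulr_suml; apply: eq_bigr => i _; rewrite -mulrA; congr (_ * _).
  rewrite big_mkcond big_ord_recr /= -big_mkcond /=.
  rewrite -val_eqE /= neq_ltn ltn_ord orbT.
  by congr (_ * _); apply: eq_bigl => j; rewrite -!val_eqE.
rewrite big_mkcond big_ord_recr /= eqxx mulr1; apply: eq_bigr => j _.
by rewrite -val_eqE /= neq_ltn ltn_ord.
Qed.

End SumProd.

(** The extra product on the left stands for the factor [n - 1]: no truncated subtraction occurs,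
    and the induction starts at [n = 0]. *)
Lemma sum_prod_neq_le (R : numDomainType) (n : nat) (P d : 'I_n -> R) :
  (forall i, 0 <= d i <= P i) ->
  \sum_i P i * \prod_(j | j != i) d j + \prod_i d i <=
    \prod_i P i + n%:R * \prod_i d i.
Proof.
elim: n P d => [|n IHn] P d dP; first by rewrite !big_ord0 mul0r addr0 add0r.
rewrite sum_prod_neq_recr !big_ord_recr /=.
set w := widen_ord (leqnSn n).
set E := \sum_i P (w i) * _; set D := \prod_i d (w i); set Q := \prod_i P (w i).
have [/andP [d0 dp]] := dP ord_max.
have /andP [D0 DQ] : 0 <= D <= Q.
  apply/andP; split; first by apply: prodr_ge0 => i _; case/andP: (dP (w i)).
  by apply: ler_prod => i _; exact: dP.
have := ler_wpM2r d0 (IHn (P \o w) (d \o w) (fun i => dP (w i))) => /=.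
rewrite -/E -/D -/Q => IH.
rewrite -subr_ge0 -natr1.
have -> : Q * P ord_max + (n%:R + 1) * (D * d ord_max) -
    (E * d ord_max + P ord_max * D + D * d ord_max) =
    ((Q + n%:R * D) * d ord_max - (E + D) * d ord_max) +
    (Q - D) * (P ord_max - d ord_max) by ring.
by rewrite addr_ge0 ?mulr_ge0 ?subr_ge0.
Qed.

(** Pairs of indices are sorted by their maximum [k]. Applied entrywise, this splits the Khatri-Rao
    product of two sums. *)
Lemma sum_mul_triangle (R : comPzRingType) (n : nat) (f g : 'I_n -> R) :
  (\sum_k f k) * (\sum_k g k) =
  \sum_k (f k * g k + (\sum_(l < n | (l < k)%N) f l) * g k
          + f k * \sum_(l < n | (l < k)%N) g l).
Proof.
elim: n => [|n IHn] in f g *; first by rewrite !big_ord0 mul0r.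
rewrite !big_ord_recr /= mulrDl !mulrDr IHn.
have max_sum (h : 'I_n.+1 -> R) :
    \sum_(l < n.+1 | (l < n)%N) h l = \sum_l h (widen_ord (leqnSn n) l).
  rewrite big_mkcond big_ord_recr /= ltnn addr0; apply: eq_bigr => l _ /=.
  by rewrite ltn_ord.
have low_sum (h : 'I_n.+1 -> R) (k : 'I_n) :
    \sum_(l < n.+1 | (l < k)%N) h l =
    \sum_(l < n | (l < k)%N) h (widen_ord (leqnSn n) l).
  rewrite big_mkcond big_ord_recr /= ltnNge (ltnW (ltn_ord k)) /= addr0.
  by rewrite -big_mkcond.
rewrite !max_sum; under [in RHS]eq_bigr do rewrite !low_sum.
ring.
Qed.

(** * Sizes, exponents and block order *)

Lemma khatri_rao_dimSE (m : nat) (q : 'I_m.+1 -> nat) :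
  khatri_rao_dimS q = (\prod_i q i)%N.
Proof.
elim: m q => [|m IHm] q /=; rewrite big_ord_recr /= ?IHm // big_ord0 mul1n.
by congr q; apply/val_inj.
Qed.

(** For positive sizes each exponent is the product of the other sizes; this is the recursion that
    [det_tens] produces. *)
Lemma prod_expr_divn_recr (R : comPzRingType) (m : nat) (q : 'I_m.+1 -> nat)
    (x : 'I_m.+1 -> R) :
  (forall i, (0 < q i)%N) ->
  let w := widen_ord (leqnSn m) in
  \prod_i x i ^+ ((\prod_j q j) %/ q i) =
  (\prod_i x (w i) ^+ ((\prod_j q (w j)) %/ q (w i))) ^+ q ord_max
    * x ord_max ^+ (\prod_j q (w j)).
Proof.
move=> q0 w; rewrite !big_ord_recr /= mulnK // -prodrXl; congr (_ * _).
apply: eq_bigr => i _; rewrite -exprM; congr (_ ^+ _).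
by rewrite divn_mulAC // (bigD1 i) //= dvdn_mulr.
Qed.

Lemma blk_lt (n q : nat) (x y : 'I_(\sum_(k < n) q)) :
  (blk x < blk y)%N -> (x < y)%N.
Proof.
rewrite !ltnNge; apply: contra => yx.
exact: (@tagnat.le_sig1 n (fun=> q) y x yx).
Qed.

(** * Positive semidefinite matrices *)

Section PositiveSemidefinite.

Variable C : numClosedFieldType.

Lemma trCmx_mul (m n p : nat) (A : 'M[C]_(m, n)) (B : 'M_(n, p)) :
  (A *m B)^H = B^H *m A^H.
Proof. by rewrite map_mxM trmx_mul. Qed.

Lemma trCmxK (m n : nat) (A : 'M[C]_(m, n)) : (A^H)^H = A.
Proof. by apply/matrixP=> i j; rewrite !mxE conjCK. Qed.

Lemma det_trCmx (n : nat) (A : 'M[C]_n) : \det A^H = (\det A)^*.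
Proof. by rewrite det_tr det_map_mx. Qed.

Lemma psdmxP (n : nat) (A : 'M[C]_n) :
  psdmx A <-> A^H = A /\ forall v : 'cV_n, 0 <= (v^H *m A *m v) 0 0.
Proof.
have hE : (A \is hermsymmx) <-> A^H = A.
  rewrite is_hermitianmxE expr0 scale1r -map_trmx; split=> [/eqP //|->].
  exact: eqxx.
by rewrite /psdmx; split=> -[/hE].
Qed.

Lemma psdmx_congr (m n : nat) (A : 'M[C]_n) (M : 'M_(m, n)) :
  psdmx A -> psdmx (M *m A *m M^H).
Proof.
move=> /psdmxP [hA A0]; apply/psdmxP; split=> [|v].
  by rewrite !trCmx_mul trCmxK hA mulmxA.
have := A0 (M^H *m v); rewrite trCmx_mul trCmxK.
by rewrite !mulmxA.
Qed.

Lemma psdmxD (n : nat) (A B : 'M[C]_n) : psdmx A -> psdmx B -> psdmx (A + B).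
Proof.
move=> /psdmxP [hA A0] /psdmxP [hB B0]; apply/psdmxP; split=> [|v].
  by rewrite map_mxD linearD /= hA hB.
by rewrite mulmxDr mulmxDl mxE addr_ge0.
Qed.

Lemma psdmxZ (n : nat) (c : C) (A : 'M[C]_n) : 0 <= c -> psdmx A -> psdmx (c *: A).
Proof.
move=> c0 /psdmxP [hA A0]; apply/psdmxP; split=> [|v].
  by rewrite map_mxZ linearZ /= hA geC0_conj.
by rewrite -scalemxAr -scalemxAl mxE mulr_ge0.
Qed.

Lemma psdmx0 (n : nat) : psdmx (0 : 'M[C]_n).
Proof.
apply/psdmxP; split=> [|v]; first by rewrite map_mx0 trmx0.
by rewrite mulmx0 mul0mx mxE.
Qed.

Lemma psdmx_sum (n : nat) (I : Type) (r : seq I) (P : pred I) (F : I -> 'M[C]_n) :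
  (forall i, P i -> psdmx (F i)) -> psdmx (\sum_(i <- r | P i) F i).
Proof. by move=> F0; apply: big_ind => //; [exact: psdmx0 | exact: psdmxD]. Qed.

(** Congruence by rows of the identity. Repeated indices are what turns Kronecker and Khatri-Rao
    products into Hadamard products. *)
Lemma psdmx_mxsub (m n : nat) (f : 'I_m -> 'I_n) (A : 'M[C]_n) :
  psdmx A -> psdmx (mxsub f f A).
Proof.
move=> A0; suff -> : mxsub f f A = rowsub f 1%:M *m A *m (rowsub f 1%:M)^H.
  exact: psdmx_congr.
rewrite map_mxsub map_mx1 trmx_mxsub trmx1 mulmx_colsub mulmx1 -rowsubE.
by apply/matrixP=> i j; rewrite !mxE.
Qed.

Lemma psdmx_diag_ge0 (n : nat) (A : 'M[C]_n) (i : 'I_n) : psdmx A -> 0 <= A i i.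
Proof.
move=> /psdmxP [_ /(_ (delta_mx i 0))].
by rewrite map_delta_mx trmx_delta -rowE -colE !mxE.
Qed.

Lemma psdmx_diag (n : nat) (d : 'rV[C]_n) :
  (forall i, 0 <= d 0 i) -> psdmx (diag_mx d).
Proof.
move=> d0; apply/psdmxP; split=> [|v].
  rewrite map_diag_mx tr_diag_mx; congr diag_mx.
  by apply/rowP=> i; rewrite mxE /= geC0_conj.
rewrite -mulmxA mul_diag_mx mxE sumr_ge0 // => i _.
by rewrite !mxE mulrCA mulr_ge0 // mulrC mul_conjC_ge0.
Qed.

(** At the vector with components [- s] and [u^H] the form equals [c - s * r *+ 2], where [r] is the
    squared norm of [u]; it stays nonnegative for all [s >= 0] only if [r = 0]. *)
Lemma psdmx_null_row (n : nat) (u : 'rV[C]_n) (B : 'M_n) :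
  psdmx (block_mx (0 : 'M_1) u u^H B) -> u = 0.
Proof.
move=> /psdmxP [_ A0].
pose r := (u *m u^H) 0 0; pose c := (u *m B *m u^H) 0 0.
have rE : r = \sum_i `|u 0 i| ^+ 2.
  by rewrite /r mxE; apply: eq_bigr => i _; rewrite !mxE normCK.
have r0 : 0 <= r by rewrite rE sumr_ge0 // => i _; rewrite exprn_ge0.
have quad s : 0 <= s -> 0 <= c - s * r *+ 2.
  move=> s0; have := A0 (col_mx (- s)%:M u^H).
  rewrite map_col_mx tr_col_mx trCmxK map_scalar_mx tr_scalar_mx.
  rewrite mul_row_block !mulmx0 add0r mul_row_col mul_scalar_mx mulmxDl.
  rewrite -scalemxAl mul_mx_scalar ![addmx _ _ _ _]mxE ![scalemx _ _ _ _]mxE.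
  rewrite -/r -/c /= rmorphN /= geC0_conj //.
  by rewrite !mulNr addrA addrC mulr2n opprD.
have c0 : 0 <= c by have := quad 0 (lexx _); rewrite mul0r mul0rn subr0.
suff r_eq0 : r = 0.
  move: r_eq0; rewrite rE => /eqP; rewrite psumr_eq0; last first.
    by move=> i _; rewrite exprn_ge0.
  move=> /allP h; apply/rowP=> i; have := h i (mem_index_enum _).
  by rewrite expf_eq0 /= normr_eq0 mxE => /eqP.
have [//|r_neq0] := eqVneq r 0.
have r_gt0 : 0 < r by rewrite lt0r r_neq0.
(* This [s] gives the form the negative value [- (c + 2)]. *)
have := quad ((c + 1) / r) (divr_ge0 (addr_ge0 c0 ler01) r0).
rewrite divfK // (_ : c - _ = - (c + 2)); last by ring.
by rewrite oppr_ge0 lt_geF // ltr_wpDl.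
Qed.

(** * Unit triangular factorization *)

Definition unit_trig (n : nat) (L : 'M[C]_n) : Prop :=
  is_trig_mx L /\ forall i, L i i = 1.

Lemma det_unit_trig (n : nat) (L : 'M[C]_n) : unit_trig L -> \det L = 1.
Proof. by case=> /det_trig -> L1; rewrite big1. Qed.

Definition ldl (n : nat) (L : 'M[C]_n) (d : 'rV[C]_n) : 'M[C]_n :=
  L *m diag_mx d *m L^H.

Lemma ldlE (n : nat) (L : 'M[C]_n) (d : 'rV_n) i j :
  ldl L d i j = \sum_k L i k * d 0 k * (L j k)^*.
Proof.
by rewrite /ldl mul_mx_diag mxE; apply: eq_bigr => k _; rewrite !mxE.
Qed.

Lemma psdmx_ldl (n : nat) (L : 'M[C]_n) (d : 'rV_n) :
  (forall i, 0 <= d 0 i) -> psdmx (ldl L d).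
Proof. by move=> d0; apply: psdmx_congr; exact: psdmx_diag. Qed.

Lemma det_ldl (n : nat) (L : 'M[C]_n) (d : 'rV_n) :
  unit_trig L -> \det (ldl L d) = \prod_i d 0 i.
Proof.
move=> L1; rewrite !det_mulmx det_trCmx det_unit_trig // rmorph1 mulr1 mul1r.
exact: det_diag.
Qed.

(** Gaussian elimination without pivoting, by induction on the Schur complement. *)
Lemma psdmx_ldl_decomposition (n : nat) (A : 'M[C]_n) : psdmx A ->
  exists (L : 'M_n) (d : 'rV_n),
    [/\ unit_trig L, forall i, 0 <= d 0 i & A = ldl L d].
Proof.
elim: n => [|n IHn] in A *.
  exists (1%:M : 'M_0), (0 : 'rV_0); split=> [|[]//|]; last by apply/matrixP=> -[].
  by split=> [|[]//]; exact: scalar_mx_is_trig.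
rewrite -[n.+1]/(1 + n)%N in A * => A0.
pose a := A 0 0; pose l := dlsubmx A; pose B := drsubmx A.
have hA : A^H = A by case/psdmxP: A0.
have AE : A = block_mx a%:M l^H l B.
  rewrite -[A]submxK; congr block_mx.
    rewrite [LHS]mx11_scalar; congr _%:M; rewrite !mxE /a.
    by congr (A _ _); apply/val_inj.
  by rewrite -{1}hA; apply/matrixP=> i j; rewrite !mxE.
have a0 : 0 <= a := psdmx_diag_ge0 0 A0.
(* A zero pivot is harmless: [psdmx_null_row] then gives [l = 0], so [a *: c = l] in both cases. *)
pose c := a^-1 *: l.
have ca : a *: c = l.
  rewrite /c scalerA.
  have [a_eq0|a_neq0] := eqVneq a 0; last by rewrite mulfV ?scale1r.
  suff -> : l = 0 by rewrite scaler0.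
  have := @psdmx_null_row n l^H B; rewrite trCmxK => h.
  rewrite -[l]trCmxK h ?map_mx0 ?trmx0 //.
  by move: A0; rewrite {1}AE a_eq0 raddf0.
have aH : a^* = a by exact: geC0_conj.
have lH : l^H = a *: c^H.
  by rewrite -{1}ca map_mxZ linearZ /= aH.
(* Compression by [W] yields the Schur complement, which thereby inherits positivity. *)
pose W := row_mx (- c) 1%:M : 'M_(n, 1 + n).
have WAW : W *m A *m W^H = B - c *m l^H.
  rewrite {1}AE mul_row_block !mul1mx mul_mx_scalar scalerN ca addNr.
  rewrite map_row_mx tr_row_mx mul_row_col mul0mx add0r map_mx1 trmx1 mulmx1.
  by rewrite mulNmx addrC.
have [L [d [[Ltrig L1] d0 BE]]] := IHn _ (psdmx_congr W A0).
exists (block_mx 1%:M 0 c L : 'M_(1 + n)), (row_mx a%:M d : 'rV_(1 + n)); split.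
- split; first by rewrite is_trig_block_mx // eqxx Ltrig scalar_mx_is_trig.
  move=> k; rewrite -[k]splitK; case: split => j /=.
    by rewrite block_mxEul !mxE eqxx.
  by rewrite block_mxEdr L1.
- move=> k; rewrite -[k]splitK; case: split => j /=; last by rewrite row_mxEr.
  by rewrite row_mxEl ord1 !mxE mulr1n.
- rewrite /ldl diag_mx_row mulmx_block.
  rewrite map_block_mx tr_block_mx mulmx_block !map_mx0 !trmx0 !map_mx1 !trmx1.
  rewrite !mulmx0 !mul0mx !addr0 !add0r !mul1mx !mulmx1.
  rewrite (_ : diag_mx a%:M = a%:M); last first.
    by apply/matrixP=> i j; rewrite !ord1 !mxE.
  rewrite mul0mx addr0 mul_mx_scalar ca mul_scalar_mx -lH -/(ldl L d) -BE WAW.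
  by rewrite [in c *m _]lH -scalemxAr scalemxAl ca addrC subrK.
Qed.

Lemma psdmx_det_ge0 (n : nat) (A : 'M[C]_n) : psdmx A -> 0 <= \det A.
Proof.
by move=> /psdmx_ldl_decomposition [L [d [L1 d0 ->]]]; rewrite det_ldl // prodr_ge0.
Qed.

(** [P] inverts the triangular factor; [\det P = 1] preserves the determinant of every matrix
    transformed along with [A]. *)
Lemma psdmx_diagonalization (n : nat) (A : 'M[C]_n) : psdmx A ->
  exists (P : 'M_n) (d : 'rV_n),
    [/\ \det P = 1, forall i, 0 <= d 0 i & P *m A *m P^H = diag_mx d].
Proof.
move=> /psdmx_ldl_decomposition [L [d [L1 d0 ->]]].
have uL : L \in unitmx by rewrite unitmxE det_unit_trig // unitr1.
exists (invmx L), d; split=> //; first by rewrite det_inv det_unit_trig // invr1.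
rewrite /ldl !mulmxA mulVmx // mul1mx -mulmxA -trCmx_mul mulVmx //.
by rewrite map_mx1 trmx1 mulmx1.
Qed.

(** * Monotonicity and supermodularity of the determinant; Schur products *)

Lemma psdmx_add_delta (n : nat) (A : 'M[C]_n) (i : 'I_n) (c : C) :
  0 <= c -> psdmx A -> psdmx (A + c *: delta_mx i i).
Proof.
move=> c0 A0; apply: psdmxD => //; apply: psdmxZ => //.
have -> : delta_mx i i = diag_mx (delta_mx 0 i) :> 'M[C]_n.
  apply/matrixP=> j k; rewrite !mxE eqxx /=.
  have [->|jk] := eqVneq j k; first by rewrite andbb mulr1n.
  by rewrite mulr0n; case: eqVneq => //= <-; rewrite eq_sym (negPf jk).
by apply: psdmx_diag => j; rewrite mxE ler0n.
Qed.

Lemma psdmx_minor (n : nat) (A : 'M[C]_n) (i : 'I_n) :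
  psdmx A -> psdmx (row' i (col' i A)).
Proof.
have -> : row' i (col' i A) = mxsub (lift i) (lift i) A.
  by apply/matrixP=> j k; rewrite !mxE.
exact: psdmx_mxsub.
Qed.

(** Each added entry contributes a nonnegative multiple of a principal minor, by [det_add_delta]. *)
Lemma le_det_add_diag (n : nat) (A : 'M[C]_n) (d : 'I_n -> C) (r : seq 'I_n) :
  (forall i, 0 <= d i) -> psdmx A ->
  \det A <= \det (A + \sum_(i <- r) d i *: delta_mx i i).
Proof.
move=> d0; elim: r A => [|i r IHr] A A0; first by rewrite big_nil addr0.
rewrite big_cons addrA; apply: le_trans (IHr _ (psdmx_add_delta i (d0 i) A0)).
by rewrite det_add_delta lerDl mulr_ge0 // psdmx_det_ge0 //; exact: psdmx_minor.
Qed.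

(** A congruence of determinant 1 makes [B] diagonal. *)
Lemma psdmx_le_det (n : nat) (A B : 'M[C]_n) :
  psdmx A -> psdmx B -> \det A <= \det (A + B).
Proof.
move=> A0 /psdmx_diagonalization [P [d [P1 d0 dE]]].
have detE M : \det M = \det (P *m M *m P^H).
  by rewrite !det_mulmx det_trCmx P1 rmorph1 mulr1 mul1r.
rewrite (detE A) (detE (A + B)) mulmxDr mulmxDl dE diag_mx_sum_delta.
by apply: le_det_add_diag => //; exact: psdmx_congr.
Qed.

Lemma psdmx_expr_det_le (n e : nat) (A B : 'M[C]_n) : psdmx A -> psdmx B ->
  0 <= \det A ^+ e <= \det (A + B) ^+ e.
Proof.
move=> A0 B0; have dA := psdmx_det_ge0 A0; have dAB := psdmx_det_ge0 (psdmxD A0 B0).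
by rewrite exprn_ge0 //= lerXn2r ?nnegrE // psdmx_le_det.
Qed.

(* Adding one diagonal entry increases the determinant by a principal minor,
   which is itself monotone. *)
Lemma det_add_diag_supermodular (n : nat) (A B : 'M[C]_n) (d : 'I_n -> C)
    (r : seq 'I_n) :
  (forall i, 0 <= d i) -> psdmx A -> psdmx B ->
  \det (A + B) - \det A <= \det (A + B + \sum_(i <- r) d i *: delta_mx i i)
    - \det (A + \sum_(i <- r) d i *: delta_mx i i).
Proof.
move=> d0 + B0; elim: r A => [|i r IHr] A A0; first by rewrite big_nil !addr0.
rewrite big_cons !addrA; have := IHr _ (psdmx_add_delta i (d0 i) A0).
rewrite -(addrAC A B); apply: le_trans; rewrite !det_add_delta opprD addrACA lerDl.
rewrite -mulrBr mulr_ge0 // subr_ge0 !raddfD /=.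
by apply: psdmx_le_det; exact: psdmx_minor.
Qed.

(** Equivalently, [\det (A + B) - \det A] grows when [A] becomes [A + D]; a congruence of
    determinant 1 makes [D] diagonal. *)
Lemma det_supermodular (n : nat) (A B D : 'M[C]_n) :
  psdmx A -> psdmx B -> psdmx D ->
  \det (A + B) + \det (A + D) <= \det (A + B + D) + \det A.
Proof.
move=> A0 B0 /psdmx_diagonalization [P [d [P1 d0 dE]]].
have detE M : \det M = \det (P *m M *m P^H).
  by rewrite !det_mulmx det_trCmx P1 rmorph1 mulr1 mul1r.
rewrite -lerBrDr addrAC -lerBlDr.
rewrite (detE A) (detE (A + B)) (detE (A + D)) (detE (A + B + D)).
rewrite !mulmxDr !mulmxDl dE diag_mx_sum_delta.
by apply: det_add_diag_supermodular => //; exact: psdmx_congr.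
Qed.

(** Schur product theorem: [A] is a nonnegative combination of rank-one matrices [l *m l^H], and the
    Hadamard product with such a matrix is congruence by the diagonal matrix of [l]. *)
Lemma psdmx_hadamard (n : nat) (A B : 'M[C]_n) :
  psdmx A -> psdmx B -> psdmx (\matrix_(i, j) (A i j * B i j)).
Proof.
move=> /psdmx_ldl_decomposition [L [d [L1 d0 ->]]] B0.
have -> : \matrix_(i, j) (ldl L d i j * B i j) =
    \sum_k d 0 k *: (diag_mx (col k L)^T *m B *m (diag_mx (col k L)^T)^H).
  apply/matrixP=> i j; rewrite mxE ldlE mulr_suml summxE; apply: eq_bigr => k _.
  rewrite map_diag_mx tr_diag_mx mul_mx_diag mul_diag_mx !mxE /=.
  ring.
by apply: psdmx_sum => k _; apply: psdmxZ => //; exact: psdmx_congr.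
Qed.

End PositiveSemidefinite.

(** * Block decompositions *)

Section BlockDecomposition.

Variable C : numClosedFieldType.

(** Blocks of different matrices are gathered into one block-diagonal matrix, whose single
    determinant can then be factored. *)
Lemma prod_det_mxblk (n q : nat) (F : 'I_n -> blockmx C n q) :
  \prod_k \det (mxblk (F k) k k) =
  \det (\matrix_(x, y) if blk x == blk y then F (blk x) x y else 0).
Proof.
rewrite -(@det_mxdiag C n (fun=> q) (fun k => mxblk (F k) k k)); congr (\det _).
apply/matrixP=> x y; rewrite [RHS]mxE [LHS]mxE.
case: eqP => [e|_]; last by rewrite mxE.
rewrite conform_mx_id [X in mxblk _ _ X]e mxE.
by rewrite (tagnat.sig2K x) (tagnat.sig2K y).
Qed.

(** In block [(k, k)] only the columns of block [k] contribute: earlier ones have zero pivots, later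
    ones vanish by triangularity. The gathered matrix is thus [ldl M D] with [M] block diagonal. *)
Lemma prod_det_mxblk_ldl (n q : nat) (L : 'I_n -> blockmx C n q)
    (d : 'I_n -> 'rV[C]_(\sum_(k < n) q)) :
  (forall k, unit_trig (L k)) ->
  (forall (k : 'I_n) (x : 'I_(\sum_(k < n) q)), (blk x < k)%N -> d k 0 x = 0) ->
  \prod_k \det (mxblk (ldl (L k) (d k)) k k) = \prod_x d (blk x) 0 x.
Proof.
move=> L1 d0; rewrite prod_det_mxblk.
pose M : blockmx C n q := \matrix_(x, j) if blk x == blk j then L (blk j) x j else 0.
pose D : 'rV_(\sum_(k < n) q) := \row_j d (blk j) 0 j.
have M1 : unit_trig M.
  split=> [|x]; last by rewrite mxE eqxx; case: (L1 (blk x)).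
  apply/is_trig_mxP=> x y xy; rewrite mxE; case: eqP => // _.
  by case: (L1 (blk y)) => /is_trig_mxP ->.
transitivity (\det (ldl M D)); last first.
  by rewrite det_ldl //; apply: eq_bigr => x _; rewrite mxE.
congr (\det _); apply/matrixP=> x y; rewrite mxE !ldlE.
case: eqP => [e|ne]; last first.
  rewrite big1 // => k _; rewrite !mxE; case: eqP => [e|_]; last by rewrite !mul0r.
  by case: eqP => [e'|_]; [case: ne; rewrite e e' | rewrite rmorph0 mulr0].
apply: eq_bigr => k _; rewrite !mxE -e; case: eqP => [->//|/eqP ne].
rewrite rmorph0 mulr0; have : (blk k < blk x)%N || (blk x < blk k)%N.
  by rewrite orbC -neq_ltn.
case/orP=> [/d0 ->|/blk_lt xk]; first by rewrite mulr0 mul0r.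
by case: (L1 (blk x)) => /is_trig_mxP -> // _; rewrite !mul0r.
Qed.

Lemma psdmx_block_decomposition (n q : nat) (A : blockmx C n q) : psdmx A ->
  exists F : 'I_n -> blockmx C n q,
    [/\ forall k, psdmx (F k), A = \sum_k F k,
        forall (k : 'I_n) (x y : 'I_(\sum_(k < n) q)), (blk x < k)%N -> F k x y = 0
      & \prod_k \det (mxblk (F k) k k) = \det A].
Proof.
move=> /psdmx_ldl_decomposition [L [d [L1 d0 ->]]].
(* Only the pivots of block [k] are kept; triangularity of [L] then clears the rows above that
   block. *)
pose e k : 'rV_(\sum_(k < n) q) := \row_j if blk j == k then d 0 j else 0.
exists (fun k => ldl L (e k)); split.
- by move=> k; apply: psdmx_ldl => j; rewrite mxE; case: ifP.
- apply/matrixP=> x y; rewrite summxE ldlE.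
  under [RHS]eq_bigr do rewrite ldlE.
  rewrite exchange_big; apply: eq_bigr => j _ /=.
  rewrite [RHS](bigD1 (blk j)) //= mxE eqxx.
  rewrite [X in _ = _ + X]big1 ?addr0 // => k /negPf.
  by rewrite mxE eq_sym => ->; rewrite mulr0 mul0r.
- move=> k x y xk; rewrite ldlE big1 // => j _; rewrite mxE.
  case: eqP => [jk|_]; last by rewrite mulr0 mul0r.
  have xj : (x < j)%N by apply: blk_lt; rewrite jk.
  by case: L1 => /is_trig_mxP -> // _; rewrite !mul0r.
- rewrite (@prod_det_mxblk_ldl n q (fun=> L)) ?det_ldl // => [|k x xk].
    by apply: eq_bigr => x _; rewrite mxE eqxx.
  by rewrite mxE; case: eqP => // e1; rewrite e1 ltnn in xk.
Qed.

(** The [F k] need not share a triangular factor, but their sum dominates one [ldl M D] with the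
    right determinant. *)
Lemma prod_det_mxblk_le_det (n q : nat) (F : 'I_n -> blockmx C n q) :
  (forall k, psdmx (F k)) ->
  (forall (k : 'I_n) (x y : 'I_(\sum_(k < n) q)), (blk x < k)%N -> F k x y = 0) ->
  \prod_k \det (mxblk (F k) k k) <= \det (\sum_k F k).
Proof.
move=> F0 Fsupp.
have /fin_all_exists [Ld LdP] :
    forall k, exists Ld : blockmx C n q * 'rV[C]_(\sum_(k < n) q),
    [/\ unit_trig Ld.1, forall j, 0 <= Ld.2 0 j & F k = ldl Ld.1 Ld.2].
  by move=> k; have [L [d]] := psdmx_ldl_decomposition (F0 k); exists (L, d).
pose L k := (Ld k).1; pose d k := (Ld k).2.
have L1 k : unit_trig (L k) by case: (LdP k).
have d0 k j : 0 <= d k 0 j by case: (LdP k).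
have FE k : F k = ldl (L k) (d k) by case: (LdP k).
(* The vanishing entry [F k x x] is a sum of nonnegative terms; the one at [x] is the pivot itself,
   as [L k] has unit diagonal. *)
have dsupp (k : 'I_n) (x : 'I_(\sum_(k < n) q)) : (blk x < k)%N -> d k 0 x = 0.
  move=> xk; have := Fsupp k x x xk; rewrite FE ldlE => /psumr_eq0P h.
  have := h _ x isT; case: (L1 k) => _ ->; rewrite rmorph1 mul1r mulr1; apply=> j _.
  by rewrite mulrAC mulr_ge0 // mul_conjC_ge0.
under eq_bigr do rewrite FE.
rewrite prod_det_mxblk_ldl //.
(* Each column of M comes from the factor attached to its own block; the terms
   left out of M, D form the positive semidefinite sum over e below. *)
pose M : blockmx C n q := \matrix_(x, j) L (blk j) x j.
pose D : 'rV_(\sum_(k < n) q) := \row_j d (blk j) 0 j.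
pose e k : 'rV_(\sum_(k < n) q) := \row_j if blk j == k then 0 else d k 0 j.
have M1 : unit_trig M.
  split=> [|x]; last by rewrite mxE; case: (L1 (blk x)).
  by apply/is_trig_mxP=> x y xy; rewrite mxE; case: (L1 (blk y)) => /is_trig_mxP ->.
have -> : \prod_x d (blk x) 0 x = \det (ldl M D).
  by rewrite det_ldl //; apply: eq_bigr => x _; rewrite mxE.
have -> : \sum_k F k = ldl M D + \sum_k ldl (L k) (e k).
  apply/matrixP=> x y; rewrite [RHS]mxE !summxE ldlE.
  under eq_bigr do rewrite FE ldlE.
  under [X in _ = _ + X]eq_bigr do rewrite ldlE.
  rewrite exchange_big [X in _ = _ + X]exchange_big -big_split.
  apply: eq_bigr => j _ /=.
  rewrite [LHS](bigD1 (blk j)) //= [X in _ = _ + X](bigD1 (blk j)) //= !mxE eqxx.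
  rewrite mulr0 mul0r add0r; congr (_ + _); apply: eq_bigr => k /negPf.
  by rewrite mxE eq_sym => ->.
apply: psdmx_le_det; first by apply: psdmx_ldl => j; rewrite mxE.
apply: psdmx_sum => k _; apply: psdmx_ldl => j; rewrite mxE.
by case: ifP.
Qed.

(** * Diagonal blocks and positivity of Khatri-Rao products *)

Lemma mxblkD (n q : nat) (A B : blockmx C n q) k l :
  mxblk (A + B) k l = mxblk A k l + mxblk B k l.
Proof. by apply/matrixP=> i j; rewrite !mxE. Qed.

Lemma mxblk_sum (n q : nat) (I : Type) (r : seq I) (P : pred I)
    (F : I -> blockmx C n q) k l :
  mxblk (\sum_(i <- r | P i) F i) k l = \sum_(i <- r | P i) mxblk (F i) k l.
Proof.
apply/matrixP=> i j; rewrite !(mxE, summxE).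
by apply: eq_bigr => s _; rewrite mxE.
Qed.

Lemma mxblk_supp (n q : nat) (F : blockmx C n q) (k l : 'I_n) :
  (forall x y : 'I_(\sum_(k < n) q), (blk x < l)%N -> F x y = 0) ->
  (k < l)%N -> mxblk F k k = 0.
Proof.
by move=> F0 kl; apply/matrixP=> i j; rewrite !mxE F0 // tagnat.Rank1K.
Qed.

Lemma psdmx_mxblk (n q : nat) (A : blockmx C n q) k : psdmx A -> psdmx (mxblk A k k).
Proof. exact: psdmx_mxsub. Qed.

(** Each diagonal block of [A] is that of [F k] plus a positive semidefinite one, while [\det A] is
    exactly the product for the [F k]. *)
Lemma fischer_inequality (n q : nat) (A : blockmx C n q) : psdmx A ->
  \det A <= \prod_k \det (mxblk A k k).
Proof.
move=> /psdmx_block_decomposition [F [F0 AE Fsupp <-]].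
apply: ler_prod => k _; rewrite psdmx_det_ge0 /=; last exact: psdmx_mxblk.
rewrite AE (bigD1 k) //= mxblkD psdmx_le_det //; apply: psdmx_mxblk => //.
exact: psdmx_sum.
Qed.

(** Common form of Kronecker and Khatri-Rao products, with [f] and [g] decoding an index into its
    components. *)
Lemma psdmx_mul_mxsub (m p q : nat) (f : 'I_m -> 'I_p) (g : 'I_m -> 'I_q)
    (A : 'M[C]_p) (B : 'M[C]_q) : psdmx A -> psdmx B ->
  psdmx (\matrix_(i, j) (A (f i) (f j) * B (g i) (g j))).
Proof.
move=> A0 B0; have := psdmx_hadamard (psdmx_mxsub f A0) (psdmx_mxsub g B0).
by congr psdmx; apply/matrixP=> i j; rewrite !mxE.
Qed.

Lemma psdmx_tens (p q : nat) (A : 'M[C]_p) (B : 'M[C]_q) :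
  psdmx A -> psdmx B -> psdmx (tensmx A B).
Proof. exact: psdmx_mul_mxsub. Qed.

Lemma khatri_raoE (n p q : nat) (A : blockmx C n p) (B : blockmx C n q) :
  khatri_rao A B =
  let f (x : 'I_(\sum_(k < n) (p * q))) := mxtens_unindex (tagnat.sig2 x) in
  \matrix_(x, y)
    (A (tagnat.Rank (blk x) (f x).1) (tagnat.Rank (blk y) (f y).1) *
     B (tagnat.Rank (blk x) (f x).2) (tagnat.Rank (blk y) (f y).2)).
Proof. by apply/matrixP=> x y; rewrite !mxE. Qed.

Lemma psdmx_khatri_rao (n p q : nat) (A : blockmx C n p) (B : blockmx C n q) :
  psdmx A -> psdmx B -> psdmx (khatri_rao A B).
Proof. by rewrite khatri_raoE; exact: psdmx_mul_mxsub. Qed.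

Lemma mxblk_khatri_rao (n p q : nat) (A : blockmx C n p) (B : blockmx C n q) k l :
  mxblk (khatri_rao A B) k l = tensmx (mxblk A k l) (mxblk B k l).
Proof. exact: mxblockK. Qed.

End BlockDecomposition.

(** * Khatri-Rao products *)

Section KhatriRao.

Variable C : numClosedFieldType.

(** [det_supermodular] based at [tensmx S T]. In [det_khatri_rao_ge], [S] and [T] are diagonal
    blocks of [F k] and [G k], and [X] and [Y] those of the earlier partial sums. *)
Lemma det_tens_supermodular (p q : nat) (S X : 'M[C]_p) (T Y : 'M[C]_q) :
  psdmx S -> psdmx X -> psdmx T -> psdmx Y ->
  \det (S + X) ^+ q * \det T ^+ p + \det S ^+ q * \det (T + Y) ^+ p <=
    \det (tensmx S T + tensmx X T + tensmx S Y) + \det S ^+ q * \det T ^+ p.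
Proof.
move=> S0 X0 T0 Y0; rewrite -!det_tens tensmxDl tensmxDr.
by apply: det_supermodular; exact: psdmx_tens.
Qed.

Lemma det_khatri_rao_ge (n p q : nat) (A : blockmx C n p) (B : blockmx C n q) :
  psdmx A -> psdmx B ->
  (\prod_k \det (mxblk A k k)) ^+ q * \det B ^+ p
    + \det A ^+ q * (\prod_k \det (mxblk B k k)) ^+ p <=
  \det (khatri_rao A B) + \det A ^+ q * \det B ^+ p.
Proof.
move=> A0 B0.
have [F [F0 AE Fsupp detF]] := psdmx_block_decomposition A0.
have [G [G0 BE Gsupp detG]] := psdmx_block_decomposition B0.
(* Terms with [l > k] vanish on block [(k, k)]. *)
have block_split r (D : blockmx C n r) (H : 'I_n -> blockmx C n r) k :
    D = \sum_k H k ->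
    (forall (k : 'I_n) (x y : 'I_(\sum_(k < n) r)), (blk x < k)%N -> H k x y = 0) ->
    mxblk D k k = mxblk (H k) k k + mxblk (\sum_(l < n | (l < k)%N) H l) k k.
  move=> -> supp; rewrite !mxblk_sum (bigD1 k) //=; congr (_ + _).
  rewrite (bigID (fun l : 'I_n => (l < k)%N)) /= [X in _ + X]big1 ?addr0.
    by apply: eq_bigl => l; rewrite neq_ltn; case: ltnP => //; rewrite andbF.
  move=> l /andP [lk]; rewrite -leqNgt => kl.
  by rewrite (mxblk_supp (supp l)) // ltn_neqAle kl andbT eq_sym.
pose Fs k := \sum_(l < n | (l < k)%N) F l; pose Gs k := \sum_(l < n | (l < k)%N) G l.
pose H k :=
  khatri_rao (F k) (G k) + khatri_rao (Fs k) (G k) + khatri_rao (F k) (Gs k).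
have Fs0 k : psdmx (Fs k) by apply: psdmx_sum.
have Gs0 k : psdmx (Gs k) by apply: psdmx_sum.
have H0 k : psdmx (H k).
  by apply: psdmxD; [apply: psdmxD|]; exact: psdmx_khatri_rao.
have HE : khatri_rao A B = \sum_k H k.
  apply/matrixP=> x y; rewrite summxE khatri_raoE mxE AE BE !summxE sum_mul_triangle.
  by apply: eq_bigr => k _; rewrite /H !khatri_raoE !mxE !summxE.
have Hsupp (k : 'I_n) (x y : 'I_(\sum_(k < n) (p * q))) :
    (blk x < k)%N -> H k x y = 0.
  move=> xk; rewrite /H !khatri_raoE !mxE.
  by rewrite (Fsupp k) ?(Gsupp k) ?mul0r ?mulr0 ?addr0 // tagnat.Rank1K.
have := prod_det_mxblk_le_det H0 Hsupp; rewrite -HE => detH.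
rewrite -lerBlDr; apply: le_trans detH; rewrite lerBlDr -detF -detG -!prodrXl.
(* Here [s], [u], [t], [v] are powers of the determinants of the blocks of [F k], [A], [G k], [B],
   and [c] is that of [H k]. *)
apply: oppenheim_prod => k.
- rewrite (block_split _ _ _ k AE Fsupp).
  exact: psdmx_expr_det_le (psdmx_mxblk k (F0 k)) (psdmx_mxblk k (Fs0 k)).
- rewrite (block_split _ _ _ k BE Gsupp).
  exact: psdmx_expr_det_le (psdmx_mxblk k (G0 k)) (psdmx_mxblk k (Gs0 k)).
- rewrite (block_split _ _ _ k AE Fsupp) (block_split _ _ _ k BE Gsupp) !mxblkD.
  rewrite !mxblk_khatri_rao; apply: det_tens_supermodular; apply: psdmx_mxblk => //.
    exact: Fs0.
  exact: Gs0.
Qed.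

(** By Fischer, both terms on the left of [det_khatri_rao_ge] are at least
    [\det A ^+ q * \det B ^+ p]; one copy cancels. *)
Lemma det_khatri_rao_ge_det (n p q : nat) (A : blockmx C n p) (B : blockmx C n q) :
  psdmx A -> psdmx B -> \det A ^+ q * \det B ^+ p <= \det (khatri_rao A B).
Proof.
move=> A0 B0; have le_det := det_khatri_rao_ge A0 B0.
have dA := psdmx_det_ge0 A0; have dB := psdmx_det_ge0 B0.
have fA := fischer_inequality A0; have fB := fischer_inequality B0.
rewrite -(lerD2r (\det A ^+ q * \det B ^+ p)); apply: le_trans le_det.
apply: lerD; [apply: ler_wpM2r | apply: ler_wpM2l]; rewrite ?exprn_ge0 //.
  by rewrite lerXn2r // nnegrE; exact: le_trans fA.
by rewrite lerXn2r // nnegrE; exact: le_trans fB.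
Qed.

Lemma det_mxblk_khatri_rao_prodS (n m : nat) (q : 'I_m.+1 -> nat)
    (A : forall i, blockmx C n (q i)) (k : 'I_n) : (forall i, (0 < q i)%N) ->
  \det (mxblk (khatri_rao_prodS A) k k) =
  \prod_i \det (mxblk (A i) k k) ^+ ((\prod_j q j) %/ q i).
Proof.
elim: m q A => [|m IHm] q A q0.
  by rewrite !big_ord1 divnn q0 expr1.
rewrite prod_expr_divn_recr //= mxblk_khatri_rao det_tens IHm //.
by rewrite khatri_rao_dimSE.
Qed.

Lemma psdmx_khatri_rao_prodS (n m : nat) (q : 'I_m.+1 -> nat)
    (A : forall i, blockmx C n (q i)) : (forall i, psdmx (A i)) ->
  psdmx (khatri_rao_prodS A).
Proof.
elim: m q A => [|m IHm] q A A0 //=.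
by apply: psdmx_khatri_rao => //; exact: IHm.
Qed.

Lemma det_khatri_rao_prodS_ge (n m : nat) (q : 'I_m.+1 -> nat)
    (A : forall i, blockmx C n (q i)) :
  (forall i, (0 < q i)%N) -> (forall i, psdmx (A i)) ->
  \prod_i \det (A i) ^+ ((\prod_j q j) %/ q i) <= \det (khatri_rao_prodS A).
Proof.
elim: m q A => [|m IHm] q A q0 A0.
  by rewrite !big_ord1 divnn q0 expr1.
rewrite prod_expr_divn_recr //=.
set w := widen_ord _; set K := khatri_rao_prodS _.
have K0 : psdmx K by exact: psdmx_khatri_rao_prodS.
apply: le_trans (det_khatri_rao_ge_det K0 (A0 ord_max)).
rewrite [in X in _ <= _ * X]khatri_rao_dimSE ler_wpM2r ?exprn_ge0 ?psdmx_det_ge0 //.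
have D0 : 0 <= \prod_i \det (A (w i)) ^+ ((\prod_j q (w j)) %/ q (w i)).
  by apply: prodr_ge0 => i _; rewrite exprn_ge0 ?psdmx_det_ge0.
by rewrite lerXn2r ?nnegrE ?psdmx_det_ge0 //; exact: IHm.
Qed.

End KhatriRao.

Theorem theorem2p6 (R : realType) (m n : nat) (q : 'I_m -> nat)
    (A : forall i : 'I_m, blockmx R[i] n (q i))
    (hm : (2 <= m)%N) (hn : (1 <= n)%N)
    (hq : forall i : 'I_m, (1 <= q i)%N)
    (hA : forall i : 'I_m, psdmx (A i)) :
  let Q := (\prod_(i < m) q i)%N in
  \det (khatri_rao_prod A)
    + (m - 1)%:R * \prod_(i < m) (\det (A i)) ^+ (Q %/ q i)
  >= \sum_(i < m)
       (\prod_(mu < n) \det (mxblk (A i) mu mu)) ^+ (Q %/ q i)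
       * \prod_(j < m | j != i) (\det (A j)) ^+ (Q %/ q j).
Proof.
case: m => [|[|m]] // in q A hm hq hA *.
set Q := (\prod_(i < m.+2) q i)%N; lazy zeta; rewrite subn1 /=.
set w := widen_ord (leqnSn m.+1).
pose d i := \det (A i) ^+ (Q %/ q i).
pose P i := (\prod_k \det (mxblk (A i) k k)) ^+ (Q %/ q i).
have dP i : 0 <= d i <= P i.
  rewrite exprn_ge0 ?psdmx_det_ge0 //=.
  rewrite lerXn2r ?nnegrE ?psdmx_det_ge0 ?fischer_inequality //.
  by apply: prodr_ge0 => k _; apply: psdmx_det_ge0; exact: psdmx_mxblk.
rewrite (sum_prod_neq_recr P d).
set K := khatri_rao_prodS _; set B := A ord_max.
set a := d ord_max; set b := P ord_max; set D := \prod_i d (w i).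
have -> : \prod_(i < m.+2) \det (A i) ^+ (Q %/ q i) = D * a by rewrite big_ord_recr.
have K0 : psdmx K by exact: psdmx_khatri_rao_prodS.
have QE : Q = (\prod_i q (w i) * q ord_max)%N by rewrite /Q big_ord_recr.
have lastE : (Q %/ q ord_max = khatri_rao_dimS (fun i => q (w i)))%N.
  by rewrite khatri_rao_dimSE QE mulnK.
have aE : \det B ^+ khatri_rao_dimS (fun i => q (w i)) = a by rewrite -lastE.
have bE : (\prod_k \det (mxblk B k k)) ^+ khatri_rao_dimS (fun i => q (w i)) = b.
  by rewrite -lastE.
have := det_khatri_rao_ge K0 (hA ord_max); rewrite -/B aE bE.
(* Diagonal blocks of [K] are Kronecker products, so their determinants are exact; for [\det K] only
   a lower bound is available. *)
have -> : (\prod_k \det (mxblk K k k)) ^+ q ord_max = \prod_i P (w i).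
  under eq_bigr do rewrite det_mxblk_khatri_rao_prodS //.
  rewrite exchange_big /= -prodrXl; apply: eq_bigr => i _.
  rewrite prodrXl -exprM; congr (_ ^+ _).
  by rewrite QE divn_mulAC // (bigD1 i) //= dvdn_mulr.
have : D <= \det K ^+ q ord_max.
  have -> : D =
      (\prod_i \det (A (w i)) ^+ ((\prod_j q (w j)) %/ q (w i))) ^+ q ord_max.
    rewrite -prodrXl; apply: eq_bigr => i _; rewrite -exprM; congr (_ ^+ _).
    by rewrite QE divn_mulAC // (bigD1 i) //= dvdn_mulr.
  rewrite lerXn2r ?nnegrE ?psdmx_det_ge0 ?det_khatri_rao_prodS_ge //.
  by apply: prodr_ge0 => i _; rewrite exprn_ge0 ?psdmx_det_ge0.
have := sum_prod_neq_le (fun i => dP (w i)); rewrite -/D.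
have /andP [a0 ab] : 0 <= a <= b by exact: dP.
set E := \sum_i _ * _; set S := \prod_i P _; set k := \det K ^+ _.
move=> hE hk hdet; rewrite -subr_ge0.
(* The gap splits into the two-factor gap, [a] times the scalar gap for the first [m.+1] factors,
   and a correction for replacing [k] by [D]. *)
have -> : \det (khatri_rao K B) + m.+1%:R * (D * a) - (E * a + b * D) =
    (\det (khatri_rao K B) + k * a - (S * a + k * b)) +
    (S + m.+1%:R * D - (E + D)) * a + (k - D) * (b - a) by ring.
apply: addr_ge0; last by rewrite mulr_ge0 ?subr_ge0.
by rewrite addr_ge0 ?mulr_ge0 ?subr_ge0.
Qed.
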